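(* Let $n$ be a positive integer and let $L$ be an $n$-dimensional nilpotent Lie algebra over $\mathbb{F}$. Then $L$ has only one upper bounded ideal, namely $L$ itself.
   Context: $\mathbb{F}$ denotes either the field of real numbers or the field of complex numbers. For an ideal $I$ of $L$, define $U(I)=\{x\in L: [x,L]\subseteq I\}$, where $[x,L]=\{[x,y]:y\in L\}$; $U(I)$ is an ideal of $L$ containing $I$. The ideal $I$ is called an upper bounded ideal of $L$ if $U(I)=I$. *)

(* Defs.v *)
From HB Require Import structures.
From mathcomp Require Import all_boot all_order all_algebra.
From mathcomp Require Import classical_sets reals complex.

Set Implicit Arguments.
Unset Strict Implicit.
Unset Printing Implicit Defensive.

Import GRing.Theory.
Local Open Scope ring_scope.
Local Open Scope complex_scope.

(* [R : realType] is any model of the real numbers. *)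
Variant scalar_kind := RealScalars | ComplexScalars.

Definition scalars (R : realType) (k : scalar_kind) : fieldType :=
  match k with
  | RealScalars => R
  | ComplexScalars => R[i]
  end.

HB.mixin Record Vector_isLieAlgebra (F : fieldType) L of Vector F L := {
  lie : L -> L -> L;
  lie_linearl : forall y, linear (lie^~ y);
  lie_linearr : forall x, linear (lie x);
  liexx : forall x, lie x x = 0;
  lie_jacobi : forall x y z,
    lie x (lie y z) + lie y (lie z x) + lie z (lie x y) = 0
}.

#[short(type="lieAlgType")]
HB.structure Definition LieAlgebra (F : fieldType) :=
  {L of Vector F L & Vector_isLieAlgebra F L}.

Section LieTheory.
Variables (F : fieldType) (L : lieAlgType F).
Implicit Types (x y : L) (I U V W : {vspace L}).

(* The span of all brackets of elements of [U] with elements of [V], computed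
   on bases as [prodv] is for products in falgebra; see [lie_prodvP]. *)
Definition lie_prodv U V : {vspace L} :=
  <<[seq lie x y | x <- vbasis U, y <- vbasis V]>>%VS.

Lemma lie_prodvP U V W :
  reflect (forall x y, x \in U -> y \in V -> lie x y \in W)
          (lie_prodv U V <= W)%VS.
Proof.
have liel a y x x' : lie (a *: x + x') y = a *: lie x y + lie x' y.
  exact: (lie_linearl y a x x').
have lier a x y y' : lie x (a *: y + y') = a *: lie x y + lie x y'.
  exact: (lie_linearr x a y y').
have lie0l y : lie 0 y = 0.
  by have := liel (- 1) y 0 0; rewrite scaler0 addr0 scaleN1r addNr.
have lie0r x : lie x 0 = 0.
  by have := lier (- 1) x 0 0; rewrite scaler0 addr0 scaleN1r addNr.
apply: (iffP idP) => [UVW x y xU yV|UVW].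
  rewrite (coord_vbasis xU) (coord_vbasis yV).
  elim/big_rec: _ => [|i u _ uW]; first by rewrite lie0l mem0v.
  rewrite liel memvD // memvZ //.
  elim/big_rec: _ => [|j v _ vW]; first by rewrite lie0r mem0v.
  rewrite lier memvD // memvZ //.
  apply: (subvP UVW); apply: memv_span; apply: allpairs_f;
    by apply: mem_nth; rewrite size_tuple.
apply/span_subvP => _ /allpairsP[[x y] /= [xU yV ->]].
by apply: UVW; apply: vbasis_mem.
Qed.

(* Indexed from 0: [lower_central k] is the term often written L^(k+1). *)
Fixpoint lower_central (k : nat) : {vspace L} :=
  if k is k'.+1 then lie_prodv fullv (lower_central k') else fullv.

Definition lie_nilpotent : Prop := exists k, lower_central k = 0%VS.

(* [L] is finite-dimensional, so every linear subspace is a [{vspace L}]; by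
   antisymmetry of the bracket, one-sided absorption is enough. *)
Definition lie_ideal I : Prop := forall x y, x \in I -> lie x y \in I.

Local Open Scope classical_set_scope.

Definition upper I : set L :=
  [set x | [set lie x y | y in [set: L]] `<=` [set` I]].

Definition upper_bounded_ideal I : Prop :=
  lie_ideal I /\ upper I = [set` I].

End LieTheory.

Arguments lie_nilpotent {F} L.

(* Main.v *)
Require Import Defs.
From mathcomp Require Import all_boot all_order all_algebra.
From mathcomp Require Import classical_sets reals complex.

(** The lower central series of a nilpotent Lie algebra reaches [0], which
    lies in every ideal [I].  When [U(I) = I] the series can be climbed back
    up inside [I]: if [I] contains the term [lower_central j.+1], which is
    spanned by the brackets of [L] with [lower_central j], then every element
    of [lower_central j] brackets [L] into [I], hence belongs to [U(I) = I]
    ([lower_central_sub_upper]).  After finitely many steps the top term,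
    which is [L], lies in [I] ([upper_bounded_ideal_full]).  Conversely [L] is
    trivially upper bounded. *)

Import GRing.Theory.
Local Open Scope ring_scope.

Section UpperBoundedIdeals.
Variables (F : fieldType) (L : lieAlgType F).
Implicit Types (x y : L) (I : {vspace L}).

Lemma lieDl x x' y : lie (x + x') y = lie x y + lie x' y.
Proof. by have := lie_linearl y 1 x x'; rewrite !scale1r. Qed.

Lemma lieDr x y y' : lie x (y + y') = lie x y + lie x y'.
Proof. by have := lie_linearr x 1 y y'; rewrite !scale1r. Qed.

Lemma lie_antisym x y : lie x y = - lie y x.
Proof.
have := liexx (x + y); rewrite lieDl !lieDr !liexx add0r addr0 => /eqP.
by rewrite addr_eq0 => /eqP.
Qed.

(** The lower central series brackets [L] on the left and [upper] brackets it
    on the right, so antisymmetry is what links the two. *)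
Lemma lower_central_sub_upper I j :
  (lower_central L j.+1 <= I)%VS ->
  forall x, x \in lower_central L j -> upper I x.
Proof.
move=> /lie_prodvP sub x xj _ [y _ <-].
by rewrite /= lie_antisym memvN; apply: sub; rewrite ?memvf.
Qed.

Lemma upper_bounded_ideal_full I :
  lie_nilpotent L -> upper_bounded_ideal I -> I = fullv.
Proof.
move=> [k Lk0] [_ UI]; apply/eqP; rewrite eqEsubv subvf /=.
have {Lk0} : (lower_central L k <= I)%VS by rewrite Lk0 sub0v.
elim: k => [//|j IHj] sub; apply: IHj; apply/subvP => x xj.
by have := lower_central_sub_upper I j sub x xj; rewrite UI.
Qed.

Lemma fullv_upper_bounded_ideal : upper_bounded_ideal (fullv : {vspace L}).
Proof.
split=> [x y _|]; first exact: memvf.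
by apply/seteqP; split=> x _; rewrite /= ?memvf // => _ [y _ <-]; apply: memvf.
Qed.

End UpperBoundedIdeals.

Theorem theorem4p3 (R : realType) (k : scalar_kind) (n : nat)
    (L : lieAlgType (scalars R k)) (hn : (0 < n)%N)
    (hdim : \dim {: L} = n) (hnil : lie_nilpotent L) :
  forall I : {vspace L}, upper_bounded_ideal I <-> I = fullv.
Proof.
move=> I; split=> [|->]; first exact: upper_bounded_ideal_full.
exact: fullv_upper_bounded_ideal.
Qed.
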